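(* The cell averages $\overline{\mathbf U}^{n+1}_{j+\frac12}$, evolved by the modified PAMPA scheme $$\overline{\mathbf U}^{n+1}_{j+\frac12}=\overline{\mathbf U}^n_{j+\frac12}-\frac{\Delta t^n}{\Delta x_{j+\frac12}}\Big(\widehat{\mathbf F}(\widehat{\mathbf U}^{n,L}_{j+1},\widehat{\mathbf U}^{n,R}_{j+1})-\widehat{\mathbf F}(\widehat{\mathbf U}^{n,L}_{j},\widehat{\mathbf U}^{n,R}_{j})\Big)$$ with an invariant-domain-preserving (IDP) numerical flux $\widehat{\mathbf F}$, are preserved within the invariant domain $G$, i.e. $\overline{\mathbf U}^{n+1}_{j+\frac12}\in G$, under the CFL condition $$\lambda_{\max}\,\frac{\Delta t^n}{\Delta x_{j+\frac12}}\le\frac16 .$$ Here all point values $\mathbf U^n_j$ and cell averages $\overline{\mathbf U}^n_{j+\frac12}$ at time level $n$ are assumed to lie in $G$, and $\widehat{\mathbf U}^{n,R}_{j}$, $\widehat{\mathbf U}^{n}_{j+\frac12}$, $\widehat{\mathbf U}^{n,L}_{j+1}$ are the values produced from them in each cell by the local scaling IDP limiter.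
   Context: Consider a one-dimensional hyperbolic system of conservation laws $\partial_t\mathbf U+\partial_x\mathbf F(\mathbf U)=\mathbf 0$, $\mathbf U\in\mathbb R^d$, with a convex invariant domain $G\subset\mathbb R^d$. The domain is divided into cells $I_{j+\frac12}=[x_j,x_{j+1}]$ of size $\Delta x_{j+\frac12}=x_{j+1}-x_j$, and $\Delta t^n=t^{n+1}-t^n$ is the time step size. The unknowns at time level $n$ are the cell averages $\overline{\mathbf U}^n_{j+\frac12}$ and the endpoint values $\mathbf U^n_j$ (approximating $\mathbf U(x_j,t^n)$). Forward Euler time discretization is used. Midpoint values: $\mathbf U^n_{j+\frac12}=\frac32\overline{\mathbf U}^n_{j+\frac12}-\frac14(\mathbf U^n_j+\mathbf U^n_{j+1})$. Local scaling IDP limiter: in each cell $I_{j+\frac12}$, with a number $\theta_{j+\frac12}\in[0,1]$ that brings the midpoint value into $G$, set $$\widehat{\mathbf U}^n_{j+\frac12}=(1-\theta_{j+\frac12})\overline{\mathbf U}^n_{j+\frac12}+\theta_{j+\frac12}\mathbf U^n_{j+\frac12}\in G,$$ $$\widehat{\mathbf U}^{n,R}_{j}=(1-\theta_{j+\frac12})\overline{\mathbf U}^n_{j+\frac12}+\theta_{j+\frac12}\mathbf U^n_{j},\qquad \widehat{\mathbf U}^{n,L}_{j+1}=(1-\theta_{j+\frac12})\overline{\mathbf U}^n_{j+\frac12}+\theta_{j+\frac12}\mathbf U^n_{j+1}.$$ The limited values lie in $G$ and satisfy the cell average decomposition $\overline{\mathbf U}^n_{j+\frac12}=\frac16\widehat{\mathbf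 U}^{n,R}_j+\frac46\widehat{\mathbf U}^n_{j+\frac12}+\frac16\widehat{\mathbf U}^{n,L}_{j+1}$. For a scalar law with $G=[U_{\min},U_{\max}]$: $\theta_{j+\frac12}=\frac{\overline u^n_{j+1/2}-U_{\min}}{\overline u^n_{j+1/2}-u^n_{j+1/2}}$ if $u^n_{j+\frac12}<U_{\min}$; $\theta_{j+\frac12}=\frac{U_{\max}-\overline u^n_{j+1/2}}{u^n_{j+1/2}-\overline u^n_{j+1/2}}$ if $u^n_{j+\frac12}>U_{\max}$; $\theta_{j+\frac12}=1$ otherwise. The limiter extends to systems. For example, for the compressible Euler equations ($\mathbf U=(\rho,\rho v,E)^T$ with density $\rho$, velocity $v$, total energy $E$, adiabatic index $\gamma$, pressure $p=(\gamma-1)(E-\frac12\rho v^2)$, and $G=\{\rho>0,\ p>0\}$), $\theta_{j+\frac12}=\theta_\rho\theta_p$, where $\theta_\rho=\frac{\overline\rho^n_{j+1/2}-\epsilon_\rho}{\overline\rho^n_{j+1/2}-\rho^n_{j+1/2}}$ if the midpoint density satisfies $\rho^n_{j+\frac12}<\epsilon_\rho$ and $\theta_\rho=1$ otherwise; $\mathbf U^*=(1-\theta_\rho)\overline{\mathbf U}^n_{j+\frac12}+\theta_\rho\mathbf U^n_{j+\frac12}$; and $\theta_p=\frac{p(\overline{\mathbf U}^n_{j+1/2})-\epsilon_p}{p(\overline{\mathbf U}^n_{j+1/2})-p(\mathbf U^* )}$ if $p(\mathbf U^* )<\epsilon_p$ and $\theta_p=1$ otherwise. Here $\epsilon_\rho=\min_j\{10^{-13},\overline\rho^n_{j+\frac12}\}$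 and $\epsilon_p=\min_j\{10^{-13},\overline p^n_{j+\frac12}\}$, where $\overline\rho^n_{j+\frac12}$ and $\overline p^n_{j+\frac12}=p(\overline{\mathbf U}^n_{j+\frac12})$ are the density and pressure of the cell average. IDP numerical flux: a numerical flux $\widehat{\mathbf F}(\mathbf U^L,\mathbf U^R)$ that is consistent, $\widehat{\mathbf F}(\mathbf U,\mathbf U)=\mathbf F(\mathbf U)$, and whose corresponding one-dimensional three-point first-order scheme is IDP, i.e. for any $\mathbf U_1,\mathbf U_2,\mathbf U_3\in G$, $$\mathbf U_2-\frac{\Delta t}{\Delta x}\Big(\widehat{\mathbf F}(\mathbf U_2,\mathbf U_3)-\widehat{\mathbf F}(\mathbf U_1,\mathbf U_2)\Big)\in G$$ under a suitable CFL condition $\lambda_{\max}\Delta t\le c_0\,\Delta x$, where $\lambda_{\max}$ denotes the maximum characteristic speed and $c_0$ is the maximum allowable CFL number for the one-dimensional first-order scheme to be IDP. For example, typically $c_0=1$ for the local Lax–Friedrichs flux.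
   Formalization: The IDP flux is assumed to have maximum allowable CFL number c_0 at least 1 (as for local Lax–Friedrichs); for an IDP flux with c_0 < 1 the bound 1/6 is not sufficient and the claim can fail. *)

(* Defs.v *)
From mathcomp Require Import all_boot all_order all_algebra.
From mathcomp Require Import all_classical all_reals all_analysis.
Import Order.TTheory GRing.Theory Num.Theory.
Import numFieldNormedType.Exports.

Set Implicit Arguments.
Unset Strict Implicit.
Unset Printing Implicit Defensive.

Local Open Scope classical_set_scope.
Local Open Scope ring_scope.

Section ConservationLaw.
Context {R : realType} {d : nat}.
Local Notation V := 'rV[R]_d.
Implicit Types (G A : set V) (F : V -> V) (Fhat : V -> V -> V).

(* ['J F U] acts on row vectors from the right, so it is the transpose of the
   textbook Jacobian matrix; diagonalizability and spectrum are unaffected.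
   [diagonalizable] is over the field R: all the eigenvalues are real. *)
Definition hyperbolic_on G F :=
  forall U, G U -> differentiable F U /\ diagonalizable ('J F U).

(* lambda_max over the states of A: the supremum of the absolute values of the
   characteristic speeds (it is +oo if they are unbounded). *)
Definition max_char_speed F A : \bar R :=
  ereal_sup [set `|s|%:E | s in
    [set s : R | exists2 U, A U & eigenvalue ('J F U) s]].

(* Given a set A of numerical states, [rng A] is the set of states over which
   "the maximum characteristic speed" is taken. Usual choices, all covered:
   A itself (compressible Euler), the convex hull of A (scalar laws with
   nonconvex flux), or the whole of G (global maximum speed). *)
Definition speed_range G (rng : set V -> set V) :=
  (forall A, A `<=` G -> A `<=` rng A /\ rng A `<=` G) /\
  (forall A B, A `<=` B -> B `<=` G -> rng A `<=` rng B).

Definition three_point_scheme Fhat (dt dx : R) (U1 U2 U3 : V) : V :=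
  U2 - (dt / dx) *: (Fhat U2 U3 - Fhat U1 U2).

Definition idp_flux G F (rng : set V -> set V) (c0 : R) Fhat :=
  (forall U, G U -> Fhat U U = F U) /\
  (forall (U1 U2 U3 : V) (dt dx : R), G U1 -> G U2 -> G U3 ->
     0 < dt -> 0 < dx ->
     (max_char_speed F (rng [set U1; U2; U3]) * dt%:E <= (c0 * dx)%:E)%E ->
     G (three_point_scheme Fhat dt dx U1 U2 U3)).

(* The mesh is indexed by int. Cell-based quantities carry the index of the
   left endpoint: index j stands for I_{j+1/2} = [x_j, x_{j+1}]. Below, [Ubar]
   and [U] are the cell averages and point values at one time level. *)
Section Limiter.
Variables (Ubar U : int -> V) (theta : int -> R).

Definition midpoint_value (j : int) : V :=
  (3 / 2) *: Ubar j - 4^-1 *: (U j + U (j + 1)).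

Definition scaled (j : int) (W : V) : V :=
  (1 - theta j) *: Ubar j + theta j *: W.

Definition limited_mid (j : int) : V := scaled j (midpoint_value j).

(* [limited_R j] is U^R_j, the limited value at x_j from the cell on its right;
   [limited_L j] is U^L_j, from the cell I_{j-1/2} on its left. *)
Definition limited_R (j : int) : V := scaled j (U j).
Definition limited_L (j : int) : V := scaled (j - 1) (U j).

Definition local_scaling_limiter G :=
  forall j, 0 <= theta j <= 1 /\ G (limited_mid j).

Definition limited_states : set V :=
  range limited_R `|` range limited_mid `|` range limited_L.

Definition pampa_average_update Fhat (dt : R) (x : int -> R) (j : int) : V :=
  Ubar j - (dt / (x (j + 1) - x j)) *:
    (Fhat (limited_L (j + 1)) (limited_R (j + 1))
     - Fhat (limited_L j) (limited_R j)).

End Limiter.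
End ConservationLaw.

(* Main.v *)
Require Import Defs.
From mathcomp Require Import all_boot all_order all_algebra.
From mathcomp Require Import all_classical all_reals all_analysis.
From mathcomp Require Import ring lra.
Import Order.TTheory GRing.Theory Num.Theory.
Import numFieldNormedType.Exports.
Local Open Scope classical_set_scope.
Local Open Scope ring_scope.

(** Simpson's rule writes a cell average as the convex combination, with
    weights 1/6, 4/6, 1/6, of the limited left endpoint, midpoint and right
    endpoint values [A], [M], [B] of the cell ([cell_average_decomposition]).
    Let [P] be the value on the left of [A] across the interface, and [Q] the
    one on the right of [B].  Inserting the interior fluxes [Fhat A M] and
    [Fhat M B], which cancel in the sum, turns the update of the average into
    the same convex combination of three first-order three-point updates, with
    stencils [(P, A, M)], [(A, M, B)] and [(M, B, Q)], on fictitious subcells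
    of widths equal to 1/6, 4/6 and 1/6 of the cell width
    ([simpson_update_split]).

    Each of them is invariant-domain preserving under its own CFL condition.
    The worst one is that of a subcell of width [dx / 6], which is where the
    bound 1/6 comes from ([subcell_cfl]).  So the three updates lie in [G], and
    by convexity so does the new average ([simpson_comb_in]). *)

Section ConvexSets.
Context {R : realType} {d : nat}.
Local Notation V := 'rV[R]_d.

Lemma convex_set_comb (G : set V) (a b : V) (p : R) :
  convex_set G -> 0 <= p <= 1 -> G a -> G b -> G ((1 - p) *: a + p *: b).
Proof.
move=> Gconv /andP[p0 p1] Ga Gb.
have /set_mem := Gconv b a (Itv01 p0 p1) (mem_set Gb) (mem_set Ga).
by rewrite addrC.
Qed.

Lemma simpson_comb_in (G : set V) (a b c : V) :
  convex_set G -> G a -> G b -> G c ->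
  G (6^-1 *: a + (4 / 6) *: b + 6^-1 *: c).
Proof.
move=> Gconv Ga Gb Gc.
(* Normalizing the weights 1/6 and 4/6 gives 1/5 and 4/5. *)
have Gab : G ((1 - 4 / 5 : R) *: a + (4 / 5 : R) *: b).
  by apply: convex_set_comb => //; lra.
suff -> : 6^-1 *: a + (4 / 6) *: b + 6^-1 *: c =
    (1 - 6^-1) *: ((1 - 4 / 5) *: a + (4 / 5) *: b) + 6^-1 *: c.
  by apply: convex_set_comb => //; lra.
by apply/rowP => i; rewrite !mxE; field.
Qed.

End ConvexSets.

Section Subcells.
Context {R : realType} {d : nat}.
Local Notation V := 'rV[R]_d.

(** The speed bound passes from all states to a three-point stencil by
    monotonicity of [rng] and of the supremum. *)
Lemma subcell_cfl (G : set V) (F : V -> V) (rng : set V -> set V)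
    (A B : set V) (c0 w dt dx : R) :
  speed_range G rng -> A `<=` B -> B `<=` G ->
  1 <= c0 -> 6^-1 <= w -> 0 < dt -> 0 < dx ->
  (max_char_speed F (rng B) * (dt / dx)%:E <= (6^-1 : R)%:E)%E ->
  (max_char_speed F (rng A) * dt%:E <= (c0 * (w * dx))%:E)%E.
Proof.
move=> [_ rng_mono] AB BG c0_ge1 w_ge dt0 dx0.
rewrite EFinM muleA lee_pdivrMr// -EFinM => cfl.
have speedAB : (max_char_speed F (rng A) <= max_char_speed F (rng B))%E.
  apply: ereal_sup_le; apply: image_subset => s [U AU sU].
  by exists U => //; exact: (rng_mono _ _ AB BG).
apply: (le_trans (lee_wpmul2r _ speedAB)); first by rewrite lee_fin ltW.
apply: (le_trans cfl); rewrite lee_fin mulrA ler_wpM2r ?(ltW dx0)//.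
by rewrite -[leLHS]mul1r ler_pM// ltW.
Qed.

Lemma simpson_update_split (Fhat : V -> V -> V) (P A M B Q : V) (dt dx : R) :
  0 < dx ->
  6^-1 *: A + (4 / 6) *: M + 6^-1 *: B
    - (dt / dx) *: (Fhat B Q - Fhat P A) =
  6^-1 *: three_point_scheme Fhat dt (6^-1 * dx) P A M
  + (4 / 6) *: three_point_scheme Fhat dt (4 / 6 * dx) A M B
  + 6^-1 *: three_point_scheme Fhat dt (6^-1 * dx) M B Q.
Proof.
move=> dx0; have dxN0 : dx != 0 by rewrite gt_eqF.
by rewrite /three_point_scheme; apply/rowP => i; rewrite !mxE; field.
Qed.

End Subcells.

Section LimitedValues.
Context {R : realType} {d : nat}.
Variables (G : set 'rV[R]_d) (Ubar U : int -> 'rV[R]_d) (theta : int -> R).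

(** Scaling towards the average leaves the Simpson mean unchanged, whatever
    the factor, because the midpoint value is chosen so that the unlimited
    mean is the average. *)
Lemma cell_average_decomposition (j : int) :
  Ubar j = 6^-1 *: limited_R Ubar U theta j
    + (4 / 6) *: limited_mid Ubar U theta j
    + 6^-1 *: limited_L Ubar U theta (j + 1).
Proof.
rewrite /limited_L addrK /limited_R /limited_mid /scaled /midpoint_value.
by apply/rowP => i; rewrite !mxE; field.
Qed.

Hypotheses (Gconv : convex_set G) (GUbar : forall j, G (Ubar j))
  (GU : forall j, G (U j)) (lim : local_scaling_limiter Ubar U theta G).

Lemma limited_states_sub : limited_states Ubar U theta `<=` G.
Proof.
move=> _ [[[j _ <-]|[j _ <-]]|[j _ <-]]; last 1 first.
- by apply: convex_set_comb => //; have [] := lim (j - 1).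
- by apply: convex_set_comb => //; have [] := lim j.
- by have [] := lim j.
Qed.

End LimitedValues.

Theorem theorem5p1 (R : realType) (d : nat) (hd : (0 < d)%N)
    (G : set 'rV[R]_d) (hG : convex_set G)
    (F : 'rV[R]_d -> 'rV[R]_d) (hF : hyperbolic_on G F)
    (rng : set 'rV[R]_d -> set 'rV[R]_d) (hrng : speed_range G rng)
    (Fhat : 'rV[R]_d -> 'rV[R]_d -> 'rV[R]_d)
    (c0 : R) (hc0 : 1 <= c0) (hFhat : idp_flux G F rng c0 Fhat)
    (x : int -> R) (hx : forall j, x j < x (j + 1))
    (t : nat -> R) (n : nat) (ht : t n < t n.+1)
    (Ubar U : nat -> int -> 'rV[R]_d) (theta : int -> R)
    (hUbar : forall j, G (Ubar n j)) (hU : forall j, G (U n j))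
    (htheta : local_scaling_limiter (Ubar n) (U n) theta G)
    (hscheme : forall j, Ubar n.+1 j =
       pampa_average_update (Ubar n) (U n) theta Fhat (t n.+1 - t n) x j) :
  forall j : int,
    (max_char_speed F (rng (limited_states (Ubar n) (U n) theta))
       * ((t n.+1 - t n) / (x (j + 1) - x j))%:E <= (6^-1 : R)%:E)%E ->
    G (Ubar n.+1 j).
Proof.
move=> j cfl; rewrite hscheme /pampa_average_update.
set dt := t n.+1 - t n in cfl *; set dx := x (j + 1) - x j in cfl *.
set S := limited_states _ _ _ in cfl.
have dt0 : 0 < dt by rewrite subr_gt0.
have dx0 : 0 < dx by rewrite subr_gt0.
have SG : S `<=` G by exact: limited_states_sub.
have subcell_in U1 U2 U3 (w : R) : S U1 -> S U2 -> S U3 -> 6^-1 <= w ->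
    G (three_point_scheme Fhat dt (w * dx) U1 U2 U3).
  move=> S1 S2 S3 w_ge; apply: (hFhat.2); rewrite ?mulr_gt0//; try exact: SG.
    by apply: lt_le_trans w_ge; rewrite invr_gt0.
  apply: (subcell_cfl _ _ _ _ _ _ _ _ _ hrng _ SG) => //.
  by move=> _ [[->|->]|->].
have SR k : S (limited_R (Ubar n) (U n) theta k) by left; left; exists k.
have SM k : S (limited_mid (Ubar n) (U n) theta k) by left; right; exists k.
have SL k : S (limited_L (Ubar n) (U n) theta k) by right; exists k.
rewrite {1}(cell_average_decomposition (Ubar n) (U n) theta j).
rewrite simpson_update_split//.
by apply: simpson_comb_in => //; apply: subcell_in => //; lra.
Qed.
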